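(* Let $d\ge 1$ and $n>d$ be integers, and write $n=qd+r$ with integers $q\ge 0$ and $2\le r\le d+1$. Then $$r\le \mathrm{gp}(\mathrm{Circ}(n,\{1,2,\ldots,d\}))\le d+1 .$$ Moreover, when $n\equiv 1\pmod d$, $\mathrm{gp}(\mathrm{Circ}(n,\{1,2,\ldots,d\}))=d+1$.
   Context: $\mathrm{Circ}(n,C)$ is the circulant digraph with vertex set $\mathbb{Z}_n$ and an arc from $x$ to $x+c \pmod n$ for every $x\in\mathbb{Z}_n$ and $c\in C$. For a digraph $D$, a set $S\subseteq V(D)$ is in general position if for any $u,v\in S$ no shortest directed $u,v$-path in $D$ passes through a vertex of $S\setminus\{u,v\}$; the general position number $\mathrm{gp}(D)$ is the maximum cardinality of a general position set of $D$. *)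

(* Defs.v *)
From mathcomp Require Import all_boot.
From mathcomp Require Import boolp.

Set Implicit Arguments.
Unset Strict Implicit.
Unset Printing Implicit Defensive.

(* A digraph is a relation [e] on a finite type of vertices.  The path        *)
(* u, x_1, ..., x_k is encoded, as for [path], by u and p = [:: x_1; ...; x_k]*)
(* so its length is [size p].                                                 *)
Definition dipath (T : finType) (e : rel T) (u v : T) (p : seq T) : bool :=
  [&& path e u p, last u p == v & uniq (u :: p)].

Definition shortest_dipath (T : finType) (e : rel T) (u v : T) (p : seq T) :
    Prop :=
  dipath e u v p /\ forall q : seq T, dipath e u v q -> size p <= size q.

Definition general_position (T : finType) (e : rel T) (S : {set T}) : Prop :=
  forall u v : T, u \in S -> v \in S ->
  forall p : seq T, shortest_dipath e u v p ->
  forall w : T, w \in S :\: [set u; v] -> w \notin u :: p.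

Definition gp_number (T : finType) (e : rel T) : nat :=
  \max_(S : {set T} | `[< general_position e S >]) #|S|.

(* Z_n is represented by its residues 'I_n rather than by 'Z_n, which has the *)
(* wrong cardinality for n < 2.                                               *)
Definition circ (n : nat) (C : seq nat) : rel 'I_n :=
  fun x y => has (fun c => y == x + c %[mod n]) C.

(* Main.v *)
Require Import Defs.
From mathcomp Require Import all_boot.
From mathcomp Require Import boolp zify.

Set Implicit Arguments.
Unset Strict Implicit.
Unset Printing Implicit Defensive.

(** In the circulant digraph with connection set {1, ..., d} on Z_n, a walk of
    length at most k leads from u to v exactly when the clockwise gap from u to
    v is at most d * k; so distances are gaps divided by d, rounded up
    ([gap_walk_le] and [walk_of_gap]).

    Upper bound.  Fix u in a general position set S.  If two other elements
    w, v of S had gaps from u congruent modulo d, say with w met first, then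
    the gap from w to v would be a multiple of d, no rounding would be lost in
    stopping at w, and w would lie on a shortest path from u to v
    ([shortest_dipath_through]).  Hence the gaps from u have distinct residues
    modulo d on S minus u, and S has at most d + 1 elements.

    Lower bound.  The r consecutive vertices 0, ..., r - 1 are in general
    position ([general_position_initial]).  A forward pair is joined by an arc.
    A backward pair is at distance q + 1, and every detour through a third
    vertex of the set has one backward leg, already of length q + 1.

    If n is congruent to 1 modulo d, then r = d + 1 and the bounds meet. *)

(** * Walks and shortest paths in a digraph *)

(** A walk of least length repeats no vertex, since removing its loops would
    shorten it. *)
Lemma shortest_walk_dipath (T : finType) (e : rel T) (u : T) (p : seq T) :
  path e u p ->
  (forall q, path e u q -> last u q = last u p -> size p <= size q) ->
  shortest_dipath e u (last u p) p.
Proof.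
move=> e_p min_p; split; last first.
  by move=> q /and3P[e_q /eqP last_q _]; apply: min_p.
rewrite /dipath e_p eqxx 2!andTb.
case: (shortenP e_p) min_p => p' e_p' uniq_p' sub_p' min_p.
apply: (@leq_size_uniq _ (u :: p')) => //.
  by move=> x; rewrite !inE => /orP[->//|/sub_p' ->]; rewrite orbT.
by rewrite ltnS; apply: min_p.
Qed.

(** Conversely a shortest path is at most as long as any walk with the same
    ends, by removing the loops of the walk. *)
Lemma shortest_dipath_le_walk (T : finType) (e : rel T) (u v : T)
    (p q : seq T) :
  shortest_dipath e u v p -> path e u q -> last u q = v -> size p <= size q.
Proof.
move=> [_ min_p] e_q; case: (shortenP e_q) => q' e_q' uniq_q' sub_q' last_q'.
have /andP[_ uniq_q''] := uniq_q'.
apply: leq_trans (uniq_leq_size uniq_q'' sub_q').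
by apply: min_p; rewrite /dipath e_q' last_q' eqxx.
Qed.

(** * Distances in the circulant digraph *)

(** The residue of v - u modulo n.  Since u, v < n, splitting on their order
    avoids the modulus and leaves linear arithmetic ([gap_cases]). *)
Definition gap (n : nat) (u v : 'I_n) : nat :=
  if u <= v then v - u else n + v - u.

Lemma gap_cases (n : nat) (u v : 'I_n) :
  (u <= v < n /\ u + gap u v = v) \/ (v < u < n /\ u + gap u v = n + v).
Proof.
have := ltn_ord u; have := ltn_ord v.
by rewrite /gap; case: (leqP u v) => *; [left | right]; split; lia.
Qed.

Lemma gap_eq0 (n : nat) (u v : 'I_n) : gap u v = 0 -> u = v.
Proof.
by have := gap_cases u v => ? ?; apply: val_inj => /=; lia.
Qed.

Lemma gap_triangle (n : nat) (u v w : 'I_n) : gap u v <= gap u w + gap w v.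
Proof.
have := gap_cases u v; have := gap_cases u w; have := gap_cases w v; lia.
Qed.

Lemma gap_split (n : nat) (u w v : 'I_n) :
  gap u w <= gap u v -> gap w v = gap u v - gap u w.
Proof.
have := gap_cases u v; have := gap_cases u w; have := gap_cases w v; lia.
Qed.

Lemma gap_surj (n : nat) (u : 'I_n) (s : nat) :
  s < n -> exists v : 'I_n, gap u v = s.
Proof.
move=> s_lt; have u_lt := ltn_ord u.
have [lt_n|ge_n] := ltnP (u + s) n.
  by exists (Ordinal lt_n); have := gap_cases u (Ordinal lt_n) => /=; lia.
have v_lt : u + s - n < n by lia.
by exists (Ordinal v_lt); have := gap_cases u (Ordinal v_lt) => /=; lia.
Qed.

Lemma circ_iota_gap (d n : nat) (x y : 'I_n) :
  d < n -> circ (iota 1 d) x y = (0 < gap x y <= d).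
Proof.
move=> d_lt; have y_lt := ltn_ord y; have gap_xy := gap_cases x y.
apply/hasP/idP => [[c]|gap_bnd].
  rewrite mem_iota (modn_small y_lt) => c_in.
  (* x + c < 2n, so the reduction modulo n is at most one subtraction. *)
  have [lt_n|ge_n] := ltnP (x + c) n.
    by rewrite modn_small // => /eqP; lia.
  rewrite -(subnK ge_n) modnDr modn_small; last by lia.
  by move=> /eqP; lia.
exists (gap x y); first by rewrite mem_iota; lia.
by case: gap_xy => -[_ ->] //; rewrite modnDl.
Qed.

Lemma gap_walk_le (d n : nat) (u : 'I_n) (p : seq 'I_n) :
  d < n -> path (circ (iota 1 d)) u p -> gap u (last u p) <= d * size p.
Proof.
move=> d_lt; elim: p u => [|x p IHp] u /=; first by have := gap_cases u u; lia.
rewrite circ_iota_gap // mulnS => /andP[/andP[_ le_ux] /IHp le_xp].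
exact: leq_trans (gap_triangle _ _ x) (leq_add le_ux le_xp).
Qed.

(** The greedy walk, advancing by d until the target is in reach, attains the
    bound of [gap_walk_le]. *)
Lemma walk_of_gap (d n k : nat) (u v : 'I_n) :
  0 < d < n -> gap u v <= d * k ->
  exists p, [/\ path (circ (iota 1 d)) u p, last u p = v & size p <= k].
Proof.
move=> /andP[d_gt0 d_lt]; elim: k u => [|k IHk] u le_uv.
  by exists [::]; split => //=; apply: gap_eq0; lia.
have [gap0|gap_gt0] := posnP (gap u v).
  by exists [::]; split => //=; apply: gap_eq0.
have [near|far] := leqP (gap u v) d.
  by exists [:: v]; split; rewrite //= circ_iota_gap // gap_gt0 near.
have [x gap_ux] := gap_surj u d_lt.
have [|p [e_p last_p size_p]] := IHk x.
  by rewrite (@gap_split _ u) gap_ux ?(ltnW far) // leq_subLR -mulnS.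
exists (x :: p); split; rewrite //= e_p circ_iota_gap // gap_ux.
by rewrite d_gt0 leqnn.
Qed.

(** * The upper bound *)

(** When w precedes v clockwise from u and the gap from w to v is a multiple
    m * d, a walk of k steps from u to v leaves k - m steps for reaching w,
    which suffice. *)
Lemma shortest_dipath_through (d n : nat) (u w v : 'I_n) :
  0 < d < n -> gap u w <= gap u v -> d %| gap w v ->
  exists2 p, shortest_dipath (circ (iota 1 d)) u v p & w \in u :: p.
Proof.
move=> d_bnd le_wv /dvdnP[m gap_wv].
have /andP[d_gt0 d_lt] := d_bnd.
have reach : exists k, gap u v <= d * k.
  by exists (gap u v); apply: leq_pmull.
have [k le_k min_k] := ex_minnP reach.
have sum_gap := gap_split le_wv.
have [|p1 [e_p1 last_p1 size_p1]] := @walk_of_gap d n (k - m) u w d_bnd.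
  by rewrite mulnBr; lia.
have [|p2 [e_p2 last_p2 size_p2]] := @walk_of_gap d n m w v d_bnd.
  by rewrite gap_wv mulnC.
have le_mk : m <= k by rewrite -(leq_pmul2l d_gt0); lia.
exists (p1 ++ p2); last by rewrite -cat_cons mem_cat -last_p1 mem_last.
have last_p : last u (p1 ++ p2) = v by rewrite last_cat last_p1.
rewrite -{1}last_p; apply: shortest_walk_dipath.
  by rewrite cat_path e_p1 last_p1.
move=> q e_q; rewrite last_p => last_q; rewrite size_cat.
have le_kq : k <= size q by apply: min_k; rewrite -last_q gap_walk_le.
apply: leq_trans _ le_kq.
by rewrite -(subnK le_mk) leq_add.
Qed.

Lemma general_position_gap_inj (d n : nat) (S : {set 'I_n}) (u w v : 'I_n) :
  0 < d < n -> general_position (circ (iota 1 d)) S ->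
  u \in S -> w \in S :\ u -> v \in S :\ u ->
  gap u w = gap u v %[mod d] -> w = v.
Proof.
move=> d_bnd gpS uS.
wlog le_wv : w v / gap u w <= gap u v => [hwlog wS vS eq_mod|].
  have [le|/ltnW le] := leqP (gap u w) (gap u v); first exact: hwlog.
  by apply/esym; apply: hwlog.
move=> /setD1P[w_neq_u wS] /setD1P[v_neq_u vS] /esym/eqP eq_mod.
have dvd : d %| gap w v by rewrite (gap_split le_wv) -eqn_mod_dvd.
have [p sp wp] := shortest_dipath_through d_bnd le_wv dvd.
apply/eqP/negPn/negP => w_neq_v.
suff /(gpS u v uS vS p sp w)/negP : w \in S :\: [set u; v] by [].
by rewrite !inE negb_or w_neq_u w_neq_v.
Qed.

Lemma general_position_card (d n : nat) (S : {set 'I_n}) :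
  0 < d < n -> general_position (circ (iota 1 d)) S -> #|S| <= d + 1.
Proof.
move=> d_bnd gpS; have /andP[d_gt0 _] := d_bnd.
have [->|[u uS]] := set_0Vmem S; first by rewrite cards0.
pose res (v : 'I_n) : 'I_d := Ordinal (ltn_pmod (gap u v) d_gt0).
have res_inj : {in S :\ u &, injective res}.
  move=> w v wS vS /(congr1 val) /= eq_mod.
  exact: (general_position_gap_inj d_bnd gpS uS wS vS).
rewrite (cardsD1 u) uS addnC leq_add2r -(card_in_imset res_inj).
by rewrite -[d in _ <= d]card_ord max_card.
Qed.

(** * The lower bound *)

Lemma general_position_initial (d n q r : nat) :
  0 < d < n -> n = q * d + r -> r <= d + 1 ->
  general_position (circ (iota 1 d)) [set i : 'I_n | i < r].
Proof.
move=> d_bnd n_eq r_le u v; rewrite !inE => u_lt v_lt p sp w.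
have /andP[_ d_lt] := d_bnd.
rewrite !inE !negb_or => /andP[/andP[w_neq_u w_neq_v] w_lt].
rewrite w_neq_u /=; apply/negP => wp.
have [/and3P[e_p /eqP last_p _] _] := sp.
(* The two legs of p have k1 > 0 and k2 > 0 arcs. *)
have [k1 [k2 [size_p le_k1 le_k2 k1_gt0 k2_gt0]]] : exists k1 k2,
    [/\ size p = k1 + k2, gap u w <= d * k1, gap w v <= d * k2,
        0 < k1 & 0 < k2].
  case/path.splitP: wp e_p last_p => p1 p2.
  rewrite cat_path last_cat last_rcons => /andP[e_p1 e_p2] last_p.
  exists (size (rcons p1 w)), (size p2); split; rewrite ?size_cat //.
  - by have := gap_walk_le d_lt e_p1; rewrite last_rcons.
  - by have := gap_walk_le d_lt e_p2; rewrite last_p.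
  - by rewrite size_rcons.
  - case: p2 last_p {e_p2 sp} => //= w_eq_v.
    by rewrite w_eq_v eqxx in w_neq_v.
have le_size k : gap u v <= d * k -> size p <= k.
  move=> /(walk_of_gap d_bnd)[s [e_s last_s]]; apply: leq_trans.
  exact: shortest_dipath_le_walk sp e_s last_s.
have ne_wu : nat_of_ord w <> u by move=> /val_inj/eqP; apply/negP.
have [le_uv|lt_vu] := leqP u v.
  by have := le_size 1; have := gap_cases u v; lia.
have size_le : k1 + k2 <= q.+1.
  by rewrite -size_p; apply: le_size; rewrite mulnS; have := gap_cases u v; lia.
(* A leg from a larger to a smaller vertex covers more than q * d. *)
have [lt_wu|le_uw] := ltnP w u.
  have : d * q < d * k1 by apply: leq_trans le_k1; have := gap_cases u w; lia.
  by rewrite ltn_mul2l; lia.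
have : d * q < d * k2 by apply: leq_trans le_k2; have := gap_cases w v; lia.
by rewrite ltn_mul2l; lia.
Qed.

Lemma card_initial (n r : nat) : r <= n -> #|[set i : 'I_n | i < r]| = r.
Proof.
move=> r_le; have widen_inj : injective (widen_ord r_le).
  by move=> i j /(congr1 val) /= /val_inj.
rewrite -[RHS]card_ord -(card_codom widen_inj).
apply: eq_card => i; rewrite inE; apply/idP/codomP => [i_lt|[j ->]] /=.
  by exists (Ordinal i_lt); apply: val_inj.
exact: ltn_ord.
Qed.

(** * The general position number *)

Theorem theorem3p2 (d n q r : nat)
  (d_ge1 : 1 <= d) (n_gt_d : d < n)
  (n_eq : n = q * d + r) (r_bounds : 2 <= r <= d + 1) :
  (r <= gp_number (@circ n (iota 1 d)) <= d + 1) /\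
  (n = 1 %[mod d] -> gp_number (@circ n (iota 1 d)) = d + 1).
Proof.
have d_bnd : 0 < d < n by rewrite d_ge1.
have /andP[r_ge2 r_le] := r_bounds.
have lower : r <= gp_number (@circ n (iota 1 d)).
  have r_le_n : r <= n by rewrite n_eq leq_addl.
  rewrite -{1}(card_initial r_le_n) /gp_number.
  apply: leq_bigmax_cond; apply/asboolP.
  exact: general_position_initial n_eq r_le.
have upper : gp_number (@circ n (iota 1 d)) <= d + 1.
  by apply/bigmax_leqP => S /asboolP; apply: general_position_card.
split; first by rewrite lower upper.
move=> n_mod; have dvd : d %| r - 1.
  by rewrite -eqn_mod_dvd ?(ltnW r_ge2) // -(modnMDl q) -n_eq; apply/eqP.
have r_eq : r = d + 1 by have := dvdn_leq _ dvd; lia.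
by apply/eqP; rewrite eqn_leq upper -r_eq lower.
Qed.
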